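(* $\displaystyle\lim_{n \to \infty} \frac{\delta_n(C_d,\mathfrak{C})}{n} = \frac{1}{2}$, where $\delta_n(C_d,\mathfrak{C})=\max\{d_T(C_d,\mathfrak{C}) : T \text{ is a tree on } n \text{ vertices}\}$.
   Context: For a tree $T$ and $u,v\in V(T)$, $d_T(u,v)$ is the number of edges of the $u$-$v$ path; for $X,Y\subseteq V(T)$, $d(X,Y)=\min\{d_T(x,y): x\in X, y\in Y\}$. A branch at $v\in V(T)$ is a maximal subtree of $T$ containing $v$ as a pendant (degree one) vertex; the weight $\omega_T(v)$ is the maximum number of edges in a branch at $v$; the centroid $C_d(T)$ is the set of vertices minimizing $\omega_T$. For $u,v\in V(T)$, $f_T(v,u)$ is the number of subtrees (connected subgraphs) of $T$ containing both $v$ and $u$. The eccentric subtree number of $v$ is $\epsilon_T(v)=\min\{f_T(v,u):u\in V(T)\}$, and the core center $\mathfrak{C}(T)$ is the set of vertices maximizing $\epsilon_T$. Write $d_T(C_d,\mathfrak{C})=d(C_d(T),\mathfrak{C}(T))$. *)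

(* Defs.v *)
From HB Require Import structures.
From mathcomp Require Import all_boot.

Set Implicit Arguments.
Unset Strict Implicit.
Unset Printing Implicit Defensive.

(* A pair (vertex set, edge set) over an ambient finType, so that a graph, its
   subgraphs, its subtrees and its branches all have the same type. *)
Definition graph (V : finType) : Type := ({set V} * {set {set V}})%type.

HB.instance Definition _ (V : finType) := Finite.on (graph V).

Section Graphs.
Variable V : finType.
Implicit Types (G H T : graph V) (u v x y : V) (X Y : {set V}).

Definition vset G : {set V} := G.1.
Definition eset G : {set {set V}} := G.2.

Definition simple_graph G : bool :=
  [forall e in eset G, (#|e| == 2) && (e \subset vset G)].

Definition adj G : rel V := [rel x y | [set x; y] \in eset G].

Definition gdegree G v : nat := #|[set e in eset G | v \in e]|.

Definition gconnected G : bool :=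
  (vset G != set0) &&
  [forall x in vset G, forall y in vset G, connect (adj G) x y].

(* A cycle has no repeated vertex, hence at most #|V| of them. *)
Definition gacyclic G : bool :=
  [forall k : 'I_#|V|.+1, (2 < k) ==>
     [forall c : k.-tuple V, ~~ ucycleb (adj G) c]].

Definition is_tree G : bool :=
  [&& simple_graph G, gconnected G & gacyclic G].

Definition is_subgraph H G : bool :=
  [&& simple_graph H, vset H \subset vset G & eset H \subset eset G].

Definition is_subtree H T : bool := is_subgraph H T && is_tree H.

Definition is_upath G u v (p : seq V) : bool :=
  [&& path (adj G) u p, last u p == v & uniq (u :: p)].

(* The number of edges of the u-v path; in a tree that path is unique, so
   exactly one k qualifies when u and v are vertices of the tree. *)
Definition tdist T u v : nat :=
  if [pick k : 'I_#|V| | [exists p : k.-tuple V, is_upath T u v p]]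
  is Some k then val k else 0.

(* For nonempty X and Y the default value #|V| is never attained, since every
   distance is smaller than #|V|. *)
Definition set_dist T X Y : nat :=
  \big[minn/#|V|]_(x in X) \big[minn/#|V|]_(y in Y) tdist T x y.

Definition pendant_subtree T v H : bool :=
  [&& is_subtree H T, v \in vset H & gdegree H v == 1].

Definition is_branch T v H : bool :=
  pendant_subtree T v H &&
  [forall K : graph V,
     pendant_subtree T v K ==> is_subgraph H K ==> (K == H)].

Definition weight T v : nat := \max_(H : graph V | is_branch T v H) #|eset H|.

Definition centroid T : {set V} :=
  [set v in vset T | [forall u in vset T, weight T v <= weight T u]].

Definition num_subtrees T v u : nat :=
  #|[set H : graph V | [&& is_subtree H T, v \in vset H & u \in vset H]]|.

Definition ecc_subtree T v : nat :=
  num_subtrees T v [arg min_(u < v in vset T) num_subtrees T v u].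

Definition core_center T : {set V} :=
  [set v in vset T | [forall u in vset T, ecc_subtree T u <= ecc_subtree T v]].

Definition centroid_core_dist T : nat :=
  set_dist T (centroid T) (core_center T).

End Graphs.

(* Every tree on n vertices is isomorphic to one with vertex set 'I_n. *)
Definition delta (n : nat) : nat :=
  \max_(T : graph 'I_n | is_tree T && (#|vset T| == n)) centroid_core_dist T.

(* Main.v *)
Require Import Defs.
From mathcomp Require Import all_boot.
From mathcomp Require Import zify.

Set Implicit Arguments.
Unset Strict Implicit.
Unset Printing Implicit Defensive.

(** The two bounds [2 * delta n <= n <= 2 * delta n + 8] are proved, and they
force the limit.

Upper bound.  A centroid vertex [c] has no path of more than [n / 2] edges
issuing from it, so no vertex, central or not, is farther than that
([centroid_upath]).  Indeed let a path [c, a, ...] have [k] edges with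
[2 * k > n].  A branch at [a] avoiding [c] grows by the edge [ca] into a
pendant subtree at [c], so it has fewer edges than the weight of [c]; a branch
at [a] containing [c] misses the [k - 1] vertices of the path beyond [a], so it
has at most [n - k < k] edges, and [k] is at most the weight of [c].  Hence [a]
is lighter than [c], a contradiction.

Lower bound.  Take a broom: a path [0, 1, ..., L], the handle, with [n - 1 - L]
leaves hung on its end [L], the hub, where [n > 2 * L].  More than half of the
tree lies strictly beyond any handle vertex other than the hub, so the centroid
stays at the hub side ([centroid_broom]).  The core center, on the contrary, is
at the tip of the handle ([core_center_broom]).  A vertex away from the tip has
few subtrees in common with the tip: if it is at least [3], at most as many as
contain [0] and [3], that is [2 ^ k + L - 3] if there are [k] leaves, according
to whether the hub belongs to the subtree.  But [2] has more than that in
common with every vertex: for the vertices up to [2] this is clear, and for the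
others it is enough to look at a leaf [l], which shares [3 * 2 ^ (k - 1)]
subtrees with [2], as the end of the subtree on the handle may be [0], [1] or
[2].  Since [k >= L] this is larger; the comparison is made by an explicit
injection ([lt_through_leaf]).  So the core center lies within [{0, 1, 2}], and
the distance is at least [L - 2].

Subtrees of a tree are counted through their vertex sets, since they are
induced subgraphs ([num_subtreesE]); those of a broom containing the vertices
[v] and [u] form the family [through v u]. *)

(** * Graphs, paths and acyclicity *)

Section TreeBasics.
Variable V : finType.
Implicit Types (G H K T : graph V) (a b c r u v x y : V) (X : {set V}).

Lemma adj_sym G : symmetric (adj G).
Proof. by move=> x y; rewrite /adj /= setUC. Qed.

Lemma connect_adj_sym G : connect_sym (adj G).
Proof. exact/sym_connect_sym/adj_sym. Qed.

Lemma adj_sub G H x y : eset H \subset eset G -> adj H x y -> adj G x y.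
Proof. by move=> /subsetP/(_ [set x; y]). Qed.

Lemma path_adj_sub G H x p :
  eset H \subset eset G -> path (adj H) x p -> path (adj G) x p.
Proof. by move=> sHG; apply: sub_path => a b; apply: adj_sub. Qed.

Lemma simpleP G e : simple_graph G -> e \in eset G ->
  exists x y, [/\ e = [set x; y], x != y, x \in vset G & y \in vset G].
Proof.
move=> /forall_inP sG eG; have /andP[/cards2P[x [y [neq_xy ->]]]] := sG e eG.
by rewrite subUset !sub1set => /andP[xG yG]; exists x, y.
Qed.

Lemma adj_vset G x y : simple_graph G -> adj G x y ->
  [/\ x != y, x \in vset G & y \in vset G].
Proof.
move=> /forall_inP sG exy; have /andP[] := sG _ exy.
rewrite cards2 subUset !sub1set => neq_xy /andP[xG yG].
by split=> //; move: neq_xy; case: (x != y).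
Qed.

Lemma path_adj_vset G x p : simple_graph G -> x \in vset G ->
  path (adj G) x p -> {subset x :: p <= vset G}.
Proof.
move=> sG; elim: p x => [|y p IHp] x xG /=; first by move=> _ z /[!inE]/eqP->.
case/andP=> /(adj_vset sG)[_ _ yG] /(IHp _ yG) sub z.
by rewrite inE => /predU1P[->|/sub].
Qed.

Lemma acyclicP G : reflect (forall c : seq V, ucycleb (adj G) c -> size c <= 2)
  (gacyclic G).
Proof.
apply: (iffP forallP) => [acG c cyc_c | acG k].
  have lt_c : size c < #|V|.+1.
    by case/andP: cyc_c => _ /card_uniqP<-; rewrite ltnS max_card.
  rewrite leqNgt; apply/negP => gt2.
  have /implyP/(_ gt2)/forallP/(_ (in_tuple c)) := acG (Ordinal lt_c).
  by rewrite /= cyc_c.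
apply/implyP => gt2; apply/forallP => c; apply/negP => /acG.
by rewrite size_tuple leqNgt gt2.
Qed.

Lemma acyclic_sub G H : eset H \subset eset G -> gacyclic G -> gacyclic H.
Proof.
move=> sHG /acyclicP acG; apply/acyclicP => c /andP[cyc_c uc]; apply: acG.
rewrite /ucycleb uc andbT; apply: sub_cycle cyc_c => x y; exact: adj_sub.
Qed.

Lemma uconnectP G x y : connect (adj G) x y ->
  exists p, is_upath G x y p.
Proof.
case/connectP=> p pth ->; case/shortenP: pth => q pth_q uq _.
by exists q; rewrite /is_upath pth_q uq eqxx.
Qed.

Lemma gconnectedP G x y : gconnected G -> x \in vset G -> y \in vset G ->
  connect (adj G) x y.
Proof.
by case/andP=> _ /forall_inP cG xG yG; apply: (forall_inP (cG x xG)).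
Qed.

Lemma gconnected_root G r : r \in vset G ->
  (forall x, x \in vset G -> connect (adj G) r x) -> gconnected G.
Proof.
move=> rG cG; apply/andP; split; first by apply/set0Pn; exists r.
apply/forall_inP => x xG; apply/forall_inP => y yG.
by apply: connect_trans (cG y yG); rewrite connect_adj_sym cG.
Qed.

(** Adjacency among the vertices other than [v]: in a tree, its connected
components are the branches at [v] with [v] removed. *)
Definition adj_off G v := [rel x y | [&& x != v, y != v & adj G x y]].

Lemma connect_adj_off_sym G v : connect_sym (adj_off G v).
Proof.
by apply: sym_connect_sym => x y; rewrite /= adj_sym andbCA.
Qed.

Lemma path_adj_off G v x p :
  v \notin x :: p -> path (adj G) x p -> path (adj_off G v) x p.
Proof.
elim: p x => //= y p IHp x; rewrite !in_cons !negb_or.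
move=> /and3P[vx vy vp] /andP[exy pth].
by rewrite eq_sym vx eq_sym vy exy IHp // inE negb_or vy.
Qed.

Lemma path_off_adj G v x p : v != x -> path (adj_off G v) x p ->
  path (adj G) x p && (v \notin x :: p).
Proof.
elim: p x => [|y p IHp] x vx /=; first by rewrite inE vx.
case/andP=> /and3P[_ yv exy] /IHp; rewrite eq_sym => /(_ yv)/andP[-> vp].
by rewrite exy inE negb_or vx.
Qed.

(** Two distinct neighbors of [v] joined by a path avoiding [v] would close up
a cycle through [v]; this is the form in which acyclicity is mostly used. *)
Lemma acyclic_neighbor_eq G v a b : simple_graph G -> gacyclic G ->
  adj G v a -> adj G v b -> connect (adj_off G v) a b -> a = b.
Proof.
move=> sG /acyclicP acG eva evb /connectP[p pth def_b].
have [va _ _] := adj_vset sG eva.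
case/shortenP: pth def_b => q /(path_off_adj va)/andP[pth_q vq] uq _ def_b.
have := acG [:: v, a & q]; rewrite /ucycleb /= rcons_path eva pth_q -def_b.
rewrite adj_sym evb vq /=; move: uq => /= -> /(_ isT).
by rewrite def_b; case: q {pth_q vq def_b}.
Qed.

(** Root the tree at a vertex [r] and charge each edge to its endpoint farther
from [r].  By [acyclic_neighbor_eq] a vertex has a single neighbor on the side
of [r], so no vertex is charged twice, and [r] is never charged. *)
Lemma tree_card_eset G : is_tree G -> #|eset G| < #|vset G|.
Proof.
case/and3P=> sG cG acG; have /set0Pn[r rG] := proj1 (andP cG).
(* [child a b] says that [b] is the neighbor of [a] towards [r]. *)
pose child a b := adj G a b && connect (adj_off G a) r b.
pose f a := [set a; odflt a [pick b | child a b]].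
suff sub : eset G \subset f @: (vset G :\ r).
  apply: leq_trans (_ : #|f @: (vset G :\ r)|.+1 <= _).
    by rewrite ltnS subset_leq_card.
  by rewrite (cardsD1 r (vset G)) rG add1n ltnS leq_imset_card.
have childE a b : a \in vset G -> a != r -> child a b ->
    [set a; b] \in f @: (vset G :\ r).
  move=> aG ar ab; apply/imsetP; exists a; first by rewrite !inE ar.
  rewrite /f; case: pickP => [b' ab' /=|/(_ b)]; last by rewrite ab.
  case/andP: ab => eab rb; case/andP: ab' => eab' rb'.
  rewrite (acyclic_neighbor_eq sG acG eab eab') //.
  by apply: connect_trans rb'; rewrite connect_adj_off_sym.
apply/subsetP => e eG; have [x [y [def_e neq_xy xG yG]]] := simpleP sG eG.
have [p /and3P[pth /eqP lp up]] := uconnectP (gconnectedP cG rG xG).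
have exy : adj G x y by rewrite /adj /= -def_e.
(* On a path from [r] to [x], either [y] comes before [x] or it is absent. *)
have [yp|yp] := boolP (y \in r :: p).
  rewrite def_e; case/splitPl: yp pth lp up => p1 p2 lp1.
  rewrite cat_path last_cat lp1 -cat_cons cat_uniq.
  case/andP=> pth1 _ lp2 /and3P[_ /hasPn no _].
  have xp1 : x \notin r :: p1.
    apply: no; case: p2 lp2 => [/esym/eqP|z p2 /= <-]; last exact: mem_last.
    by rewrite (negbTE neq_xy).
  apply: childE => //; first by move: xp1; rewrite inE; case: eqVneq.
  rewrite /child exy; apply/connectP; exists p1 => //.
  exact: path_adj_off.
rewrite def_e setUC; apply: childE => //.
  by move: yp; rewrite inE; case: eqVneq.
rewrite /child adj_sym exy; apply/connectP; exists p => //.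
exact: path_adj_off.
Qed.

(** * Subtrees of a tree *)

Lemma is_subgraph_refl G : simple_graph G -> is_subgraph G G.
Proof. by move=> sG; rewrite /is_subgraph sG !subxx. Qed.

Lemma is_subgraph_trans G H K :
  is_subgraph K H -> is_subgraph H G -> is_subgraph K G.
Proof.
case/and3P=> sK vKH eKH /and3P[_ vHG eHG].
by rewrite /is_subgraph sK (subset_trans vKH) ?(subset_trans eKH).
Qed.

Definition induced T X : graph V := (X, [set e in eset T | e \subset X]).

Lemma simple_induced T X : simple_graph T -> simple_graph (induced T X).
Proof.
move=> /forall_inP sT; apply/forall_inP => e /[!inE] /andP[/sT/andP[-> _] ->].
by [].
Qed.

Lemma adj_induced T X x y :
  adj (induced T X) x y = [&& adj T x y, x \in X & y \in X].
Proof. by rewrite /adj /= inE subUset !sub1set. Qed.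

Lemma eset_induced T X : eset (induced T X) \subset eset T.
Proof. by apply/subsetP => e /[!inE] /andP[]. Qed.

(** An edge of [T] between two vertices of [H] that is missing in [H] would
close up a cycle with the path of [H] joining them. *)
Lemma subtree_induced T H : simple_graph T -> gacyclic T -> is_subtree H T ->
  H = induced T (vset H).
Proof.
move=> sT /acyclicP acT /andP[/and3P[_ vHT eHT] /and3P[sH cH _]].
rewrite [LHS]surjective_pairing; congr (_, _); apply/setP => e.
rewrite !inE; apply/idP/andP => [eH | [eT eH]].
  by split; [apply: (subsetP eHT) | case/andP: (forall_inP sH e eH)].
have [x [y [def_e neq_xy _ _]]] := simpleP sT eT.
move: eH; rewrite def_e subUset !sub1set => /andP[xH yH].
have [p /and3P[pth /eqP lp up]] := uconnectP (gconnectedP cH xH yH).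
have eyx : adj T y x by rewrite adj_sym /adj /= -def_e.
have := acT (x :: p); rewrite /ucycleb /= rcons_path lp (path_adj_sub eHT pth).
rewrite eyx; move: (up) => /= -> /(_ isT).
case: p pth lp {up} => [_ /= /eqP|z [|//]]; first by rewrite (negbTE neq_xy).
by move=> /= /andP[exz _] <-.
Qed.

Lemma num_subtreesE T v u : simple_graph T -> gacyclic T ->
  num_subtrees T v u =
  #|[set X : {set V} | [&& X \subset vset T, gconnected (induced T X),
                           v \in X & u \in X]]|.
Proof.
move=> sT acT; rewrite /num_subtrees -[LHS](@card_in_imset _ _ (@vset V)).
  apply: eq_card => X; rewrite [RHS]inE; apply/imsetP/and4P.
    move=> [H /[!inE] /and3P[stH vH uH] ->]; split=> //.
      by case/andP: stH => /and3P[].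
    by rewrite -subtree_induced //; case/andP: stH => _ /and3P[].
  move=> [XT cX vX uX]; exists (induced T X) => //.
  rewrite inE vX uX !andbT /is_subtree /is_subgraph /is_tree XT eset_induced.
  by rewrite cX simple_induced // (acyclic_sub (eset_induced T X)).
move=> H K /[!inE] /andP[stH _] /andP[stK _] eqHK.
by rewrite (subtree_induced sT acT stH) eqHK -subtree_induced.
Qed.

(** * Weights and the centroid *)

(** Every pendant subtree extends to a maximal one, a branch.  Vertices and
edges are counted together, so that a branch of maximal size is also maximal
for inclusion. *)
Lemma pendant_le_weight T v K : pendant_subtree T v K ->
  #|eset K| <= weight T v.
Proof.
move=> pK; pose good H := pendant_subtree T v H && is_subgraph K H.
have sK : simple_graph K by case/and3P: pK => /andP[/and3P[]].
have gK : good K by rewrite /good pK is_subgraph_refl.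
case: (@arg_maxnP _ K good (fun H => #|vset H| + #|eset H|) gK).
move=> B /andP[pB KB] maxB.
apply: leq_trans (_ : #|eset B| <= _).
  by case/and3P: KB => _ _ /subset_leq_card.
apply: (@leq_bigmax_cond _ _ (fun H => #|eset H|)).
rewrite /is_branch pB; apply/forallP => H; apply/implyP => pH.
apply/implyP => BH; have := maxB H.
rewrite /good pH (is_subgraph_trans KB BH) => /(_ isT) le.
case/and3P: BH => _ vBH eBH; rewrite eq_sym.
have le_v := subset_leq_card vBH; have le_e := subset_leq_card eBH.
apply/eqP; rewrite [LHS]surjective_pairing [RHS]surjective_pairing.
rewrite /vset /eset /geq /= in le le_v le_e vBH eBH.
have arith (a b a' b' : nat) :
    a' + b' <= a + b -> a <= a' -> b <= b' -> (a' <= a) && (b' <= b).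
  by clear; lia.
have /andP[ge_v ge_e] := arith _ _ _ _ le le_v le_e.
by congr (_, _); apply/eqP; rewrite eqEcard ?vBH ?eBH.
Qed.

Lemma weight_leq T v m :
  (forall K, pendant_subtree T v K -> #|eset K| <= m) -> weight T v <= m.
Proof. by move=> le; apply/bigmax_leqP => K /andP[/le]. Qed.

(** The graph [K] with a new vertex [v] hung on its vertex [a]. *)
Definition add_pendant K a v : graph V :=
  (v |: vset K, [set v; a] |: eset K).

Lemma add_pendant_subtree T K a v : simple_graph T -> gacyclic T ->
  is_subtree K T -> a \in vset K -> v \notin vset K -> adj T v a ->
  pendant_subtree T v (add_pendant K a v) /\
  #|eset (add_pendant K a v)| = #|eset K|.+1.
Proof.
move=> sT acT /andP[/and3P[_ vKT eKT] /and3P[sK cK acK]] aK vK eva.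
have [va vT aT] := adj_vset sT eva.
have no e : e \in eset K -> v \notin e.
  move=> eK; have /andP[_ /subsetP sub] := forall_inP sK e eK.
  by apply: contra vK => /sub.
have newe : [set v; a] \notin eset K.
  by apply/negP => /no; rewrite !inE eqxx.
split; last by rewrite cardsU1 newe.
have eT : eset (add_pendant K a v) \subset eset T.
  by rewrite subUset eKT andbT sub1set.
have sK' : simple_graph (add_pendant K a v).
  apply/forall_inP => e /setU1P[->|eK].
    by rewrite cards2 va subUset !sub1set !inE eqxx aK orbT.
  case/andP: (forall_inP sK e eK) => -> /subset_trans -> //.
  by rewrite subsetUr.
apply/and3P; split; last 2 first.
- by rewrite !inE eqxx.
- rewrite /gdegree; apply/cards1P; exists [set v; a]; apply/setP => e.
  rewrite !inE; case: eqVneq => [->|_] /=; first by rewrite !inE eqxx.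
  by apply/negP => /andP[/no/negP].
apply/andP; split.
  by rewrite /is_subgraph sK' eT subUset sub1set vT vKT.
rewrite /is_tree sK' (acyclic_sub eT) // andbT.
apply: (@gconnected_root _ a); first by rewrite !inE aK orbT.
move=> x /setU1P[->|xK].
  by apply: connect1; rewrite /adj /= setUC !inE eqxx.
apply: connect_sub (gconnectedP cK aK xK) => y z eyz; apply: connect1.
by apply: adj_sub eyz; rewrite subsetUr.
Qed.

(** A path of [K] from the pendant vertex [v] must start with its only neighbor
[c] and never returns to [v]; hence [K] minus [v] is connected. *)
Lemma pendantP T v K : pendant_subtree T v K -> exists c, [/\ adj K v c,
    forall c', adj K v c' -> c' = c &
    forall x, x \in vset K -> x != v -> connect (adj_off K v) c x].
Proof.
case/and3P=> /andP[_ /and3P[sK cK _]] vK deg.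
have [e def_e] := cards1P deg.
have /setIdP[eK ve] : e \in [set e in eset K | v \in e] by rewrite def_e set11.
have [c def_ec] : exists c, e = [set v; c].
  have [x [y [Ee _ _ _]]] := simpleP sK eK.
  move: ve; rewrite Ee !inE => /orP[] /eqP ->; first by exists y.
  by exists x; rewrite setUC.
have evc : adj K v c by rewrite /adj /= -def_ec.
have uniq_c c' : adj K v c' -> c' = c.
  move=> evc'; have [vc' _ _] := adj_vset sK evc'.
  have : [set v; c'] \in [set e in eset K | v \in e].
    by rewrite inE [_ \in eset K]evc' !inE eqxx.
  rewrite def_e inE def_ec => /eqP/setP/(_ c'); rewrite !inE eqxx orbT.
  by rewrite eq_sym (negbTE vc') => /esym/eqP.
exists c; split=> // x xK xv.
have [[|c' p] /and3P[pth /eqP lp up]] := uconnectP (gconnectedP cK vK xK).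
  by rewrite -lp eqxx in xv.
move: pth up => /= /andP[/uniq_c def_c pth] /andP[vp _].
rewrite -def_c in vp *; apply/connectP; exists p => //; exact: path_adj_off.
Qed.

Lemma single_subtree T v : simple_graph T -> gacyclic T -> v \in vset T ->
  is_subtree ([set v], set0) T.
Proof.
move=> sT acT vT; have s1 : simple_graph ([set v], set0 : {set {set V}}).
  by apply/forall_inP => e /[!inE].
rewrite /is_subtree /is_subgraph /is_tree s1 sub1set vT sub0set /=.
rewrite (@acyclic_sub T) ?sub0set // andbT.
by apply: (@gconnected_root _ v) => [|x]; rewrite inE // => /eqP ->.
Qed.

(** The path itself, built from its far end by hanging one vertex at a time. *)
Lemma upath_subtree T v p : simple_graph T -> gacyclic T -> v \in vset T ->
  path (adj T) v p -> uniq (v :: p) ->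
  exists K, [/\ is_subtree K T, vset K = [set x in v :: p],
    #|eset K| = size p & p != [::] -> pendant_subtree T v K].
Proof.
move=> sT acT; elim: p v => [|a p IHp] v vT.
  exists ([set v], set0); split=> //; first exact: single_subtree.
    by apply/setP => x; rewrite !inE.
  by rewrite cards0.
move=> /= /andP[eva pth] /andP[vp up]; have [_ _ aT] := adj_vset sT eva.
have [K [stK vK eK _]] := IHp a aT pth up.
have [] := add_pendant_subtree (K := K) sT acT stK _ _ eva.
- by rewrite vK !inE eqxx.
- by rewrite vK inE.
move=> pK cK; exists (add_pendant K a v); split=> //; first by case/and3P: pK.
  by apply/setP => x; rewrite in_setU1 vK !inE.
by rewrite cK eK.
Qed.

Lemma upath_le_weight T v p : simple_graph T -> gacyclic T -> v \in vset T ->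
  path (adj T) v p -> uniq (v :: p) -> size p <= weight T v.
Proof.
case: p => // a p sT acT vT pth up.
have [K [_ _ <- /(_ isT) pK]] := upath_subtree sT acT vT pth up.
exact: pendant_le_weight.
Qed.

(** If the path [c, a, ...] were longer than half the order of the tree, moving
from [c] to [a] would decrease the weight. *)
Lemma centroid_upath T c p : is_tree T -> c \in centroid T ->
  path (adj T) c p -> uniq (c :: p) -> (size p).*2 <= #|vset T|.
Proof.
case/and3P=> sT cT acT /[!inE] /andP[vc /forall_inP minc].
case: p => // a p pth up; have := pth => /= /andP[eca pth_a].
have [ca _ aT] := adj_vset sT eca.
have le_w := upath_le_weight sT acT vc pth up.
rewrite leqNgt; apply/negP => long.
have := minc a aT; rewrite leqNgt => /negP[].
have predw : (weight T c).-1.+1 = weight T c by apply: ltn_predK le_w.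
suff: weight T a <= (weight T c).-1 by rewrite -ltnS predw.
apply: weight_leq => K pK; have /and3P[stK aK _] := pK.
have [cK|cK] := boolP (c \in vset K); last first.
  have [pK' card_eK'] := add_pendant_subtree sT acT stK aK cK eca.
  by have := pendant_le_weight pK'; rewrite card_eK' -[in _ <= _.-1]ltnS predw.
have def_K := subtree_induced sT acT stK.
have eac : adj K a c by rewrite def_K adj_induced adj_sym eca aK cK.
have [c0 [_ uniq_c conn_c]] := pendantP pK.
rewrite -(uniq_c c eac) in conn_c.
(* A vertex of [K] beyond [a] on the path would be joined, avoiding [a], to
   both [c] (inside [K]) and the successor [b] of [a] (along the path). *)
have disj : [disjoint vset K & [set x in p]].
  rewrite disjoint_sym disjoint_subset; apply/subsetP => x; rewrite inE => xp.
  apply/negP => xK; case: p xp pth_a up {pth le_w long} => // b p xp.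
  move=> /= /andP[eab pth_b].
  rewrite !inE !negb_or -!andbA => /and4P[_ cb _ /and4P[ab ap _ _]].
  move/eqP: cb; apply; apply: (@acyclic_neighbor_eq T a) => //.
    by rewrite adj_sym.
  apply: (@connect_trans _ _ x).
    have xa : x != a.
      move: xp; rewrite inE => /predU1P[->|]; first by rewrite eq_sym.
      by apply: contraL => /eqP ->.
    apply: connect_sub (conn_c x xK xa) => y z /and3P[ya za eyz].
    apply: connect1; rewrite /= ya za; apply: adj_sub eyz.
    by case/andP: stK => /and3P[].
  rewrite connect_adj_off_sym.
  have apb : a \notin b :: p by rewrite inE negb_or ab.
  have := path_adj_off apb pth_b; case/splitPl: xp => p1 p2 <-.
  by rewrite cat_path => /andP[pth1 _]; apply/connectP; exists p1.
have pT : [set x in p] \subset vset T.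
  apply/subsetP => x; rewrite inE => xp.
  by apply: (path_adj_vset sT aT pth_a); rewrite inE xp orbT.
have card_p : #|[set x in p]| = size p.
  by rewrite cardsE; apply/card_uniqP; move: up => /= /and3P[].
have le_KT : #|vset K| + size p <= #|vset T|.
  rewrite -card_p -cardsUI (disjoint_setI0 disj) cards0 addn0.
  by rewrite subset_leq_card // subUset pT andbT; case/andP: stK => /and3P[].
have lt_eK : #|eset K| < #|vset K| by apply: tree_card_eset; case/andP: stK.
have arith (e k m n w : nat) :
    e < k -> k + m <= n -> m < w -> n < m.+1.*2 -> e <= w.-1 by clear; lia.
exact: arith lt_eK le_KT le_w long.
Qed.

(** * Distances between vertex sets *)

Lemma tdist_upath T x y : is_tree T -> x \in vset T -> y \in vset T ->
  exists2 p, is_upath T x y p & tdist T x y = size p.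
Proof.
case/and3P=> _ cT _ xT yT; rewrite /tdist.
case: pickP => [k /existsP[p up]|no].
  by exists p; rewrite // size_tuple.
have [p up] := uconnectP (gconnectedP cT xT yT).
have lt_p : size p < #|V|.
  by case/and3P: up => _ _ /card_uniqP/= <-; apply: max_card.
by have /existsP[] := no (Ordinal lt_p); exists (in_tuple p).
Qed.

Lemma bigmin_le_seq (I : eqType) (r : seq I) (P : pred I) (F : I -> nat) d i :
  i \in r -> P i -> \big[minn/d]_(j <- r | P j) F j <= F i.
Proof.
elim: r => // j r IHr; rewrite inE big_cons => /predU1P[<- ->|ir Pi].
  exact: geq_minl.
by case: ifP => _; rewrite ?geq_min IHr ?orbT.
Qed.

Lemma set_dist_le T (X Y : {set V}) x y : x \in X -> y \in Y ->
  set_dist T X Y <= tdist T x y.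
Proof.
move=> xX yY; apply: leq_trans (bigmin_le_seq _ _ _ xX) _.
  by rewrite mem_index_enum.
by apply: bigmin_le_seq; rewrite ?mem_index_enum.
Qed.

Lemma le_set_dist T (X Y : {set V}) m : m <= #|V| ->
  (forall x y, x \in X -> y \in Y -> m <= tdist T x y) -> m <= set_dist T X Y.
Proof.
move=> mV le; apply: (big_ind (leq m)) => // [a b|x xX].
  by rewrite leq_min => -> ->.
apply: (big_ind (leq m)) => // [a b|y]; first by rewrite leq_min => -> ->.
exact: le.
Qed.

Lemma centroid_core_dist_le T : is_tree T ->
  (centroid_core_dist T).*2 <= #|vset T|.
Proof.
move=> tT; have /and3P[sT cT acT] := tT; have /set0Pn[r rT] := proj1 (andP cT).
have [c cC] : exists c, c \in centroid T.
  case: (@arg_minnP _ r (mem (vset T)) (weight T) rT) => c cT' minc.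
  by exists c; rewrite inE; apply/andP; split; last exact/forall_inP.
have [y yC] : exists y, y \in core_center T.
  case: (@arg_maxnP _ r (mem (vset T)) (ecc_subtree T) rT) => y yT maxy.
  by exists y; rewrite inE; apply/andP; split; last exact/forall_inP.
apply: leq_trans (_ : (tdist T c y).*2 <= _).
  by rewrite leq_double set_dist_le.
have /setIdP[cT' _] := cC; have /setIdP[yT _] := yC.
have [p /and3P[pth _ up] ->] := tdist_upath tT cT' yT.
exact: centroid_upath cC pth up.
Qed.

(** * Bounds on the eccentric subtree number *)

Lemma ecc_subtree_le T v u : v \in vset T -> u \in vset T ->
  ecc_subtree T v <= num_subtrees T v u.
Proof. by rewrite /ecc_subtree => vT uT; case: arg_minnP => // w _; apply. Qed.

Lemma ecc_subtree_gt T v m : v \in vset T ->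
  (forall u, u \in vset T -> m < num_subtrees T v u) -> m < ecc_subtree T v.
Proof.
by rewrite /ecc_subtree => vT lt; case: arg_minnP => // w wT _; apply: lt.
Qed.

End TreeBasics.

(** * Brooms *)

Lemma connect_preserved (I : finType) (e : rel I) (P : pred I) x y :
  (forall a b, e a b -> P a -> P b) -> connect e x y -> P x -> P y.
Proof.
move=> pres /connectP[p pth ->]; elim: p x pth => //= z p IHp x.
by move=> /andP[exz pth] Px; apply: IHp pth (pres _ _ exz Px).
Qed.

Lemma eq_set2 (I : finType) (x y a b : I) :
  [set x; y] = [set a; b] -> (x = a /\ y = b) \/ (x = b /\ y = a).
Proof.
move=> eq; have /set2P xab : x \in [set a; b] by rewrite -eq set21.
have /set2P yab : y \in [set a; b] by rewrite -eq set22.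
have /set2P axy : a \in [set x; y] by rewrite eq set21.
have /set2P bxy : b \in [set x; y] by rewrite eq set22.
by case: xab yab axy bxy => -> [->|->] [] ? [] ?; auto.
Qed.

Section Broom.
Variables N L : nat.
Implicit Types (a b x y z l u v : 'I_N.+1) (X Y : {set 'I_N.+1}).

(** The broom is rooted at the tip [0] of its handle: the parent of a handle
vertex is its predecessor, that of a leaf is the hub [L]. *)
Definition parent (i : nat) := minn i.-1 L.

Definition has_parent x y := (0 < x) && (y == parent x :> nat).

Definition broom : graph 'I_N.+1 :=
  (setT, [set e | [exists x, exists y, has_parent x y && (e == [set x; y])]]).

Lemma has_parent_lt x y : has_parent x y -> y < x.
Proof. by case/andP=> x0 /eqP->; rewrite /parent; clear - x0; lia. Qed.

Lemma adj_broom x y : adj broom x y = has_parent x y || has_parent y x.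
Proof.
rewrite /adj /= inE; apply/existsP/orP => [[a /existsP[b /andP[pab /eqP]]]|].
  by case/eq_set2=> -[-> ->]; [left | right].
case=> pxy.
  by exists x; apply/existsP; exists y; rewrite pxy eqxx.
by exists y; apply/existsP; exists x; rewrite pxy setUC eqxx.
Qed.

Lemma simple_broom : simple_graph broom.
Proof.
apply/forall_inP => e /[!inE] /existsP[x /existsP[y /andP[pxy /eqP->]]].
have lt_yx := has_parent_lt pxy.
rewrite cards2 subsetT andbT (_ : x != y) //.
by apply: contraTneq lt_yx => ->; rewrite ltnn.
Qed.

(** The largest vertex of a cycle would have two distinct smaller neighbors,
but its parent is its only smaller neighbor. *)
Lemma acyclic_broom : gacyclic broom.
Proof.
apply/acyclicP => c /andP[cyc_c uc]; rewrite leqNgt; apply/negP => gt2.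
have c0 : head ord0 c \in c by case: (c) gt2 => //= *; rewrite mem_head.
case: (@arg_maxnP _ _ (mem c) (@nat_of_ord _) c0) => /= m mc maxm.
have [i q def_q] := rot_to mc.
have : cycle (adj broom) (m :: q) by rewrite -def_q rot_cycle.
have : uniq (m :: q) by rewrite -def_q rot_uniq.
have : 2 < size (m :: q) by rewrite -def_q size_rot.
have {}maxm x : x \in q -> x <= m.
  by move=> xq; apply: maxm; rewrite -(mem_rot i) def_q inE xq orbT.
have par_m x : x \in q -> adj broom m x -> x = parent m :> nat.
  move=> xq; rewrite adj_broom => /orP[/andP[_ /eqP //]|/has_parent_lt].
  by rewrite ltnNge maxm.
case/lastP: q par_m {def_q maxm} => // [[|a q] b par_m] //= _.
case/and3P=> _ aq _; rewrite !rcons_path last_rcons => /and3P[ema _ ebm].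
suff /val_inj eq_ab : a = b :> nat by rewrite eq_ab mem_rcons mem_head in aq.
rewrite (par_m a) ?mem_head // (par_m b) //.
  by rewrite inE mem_rcons mem_head orbT.
by rewrite adj_sym.
Qed.

Definition node (i : nat) : 'I_N.+1 := inord i.

Lemma nodeK i : i <= N -> node i = i :> nat.
Proof. by move=> leiN; rewrite inordK. Qed.

Lemma broom_connected X x : x \in X ->
  (forall y, y \in X -> y != x -> (0 < y) && (node (parent y) \in X)) ->
  gconnected (induced broom X).
Proof.
move=> xX parX; apply: (@gconnected_root _ _ x) => // y.
have [m] := ubnP (val y); elim: m y => // m IHm y /ltnSE-le_ym yX.
have [->|yx] := eqVneq y x; first exact: connect0.
have /andP[y0 pyX] := parX y yX yx.
have le_py : parent y < y by rewrite /parent; clear - y0; lia.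
have pK : node (parent y) = parent y :> nat.
  by rewrite nodeK // -ltnS (leq_trans le_py) // ltnW.
apply: connect_trans (IHm _ _ pyX) _.
  by rewrite [X in X < _]pK (leq_trans le_py).
apply: connect1; rewrite adj_induced pyX yX !andbT adj_broom.
by rewrite /has_parent y0 pK eqxx orbT.
Qed.

Lemma broom_is_tree : is_tree broom.
Proof.
rewrite /is_tree simple_broom acyclic_broom andbT.
have -> : broom = induced broom setT.
  congr (_, _); apply/setP => e; rewrite [RHS]inE subsetT andbT //.
apply: (@broom_connected _ ord0); first exact: in_setT.
by move=> y _ y0; rewrite in_setT andbT lt0n.
Qed.

Lemma broom_connected_tail X a : a <= L ->
  (forall x, a <= x <= L -> x \in X) -> (forall x, x \in X -> a <= x) ->
  gconnected (induced broom X).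
Proof.
move=> aL subX geX; apply: (@broom_connected _ a).
  by apply: subX; rewrite leqnn.
move=> y yX ya; have lt_ay : a < y by rewrite ltn_neqAle eq_sym ya geX.
have leyN := ltn_ord y.
rewrite (leq_ltn_trans _ lt_ay) //=; apply: subX.
by rewrite nodeK /parent; clear - lt_ay aL leyN; lia.
Qed.

(** Removing the handle vertex [m] separates the smaller vertices from the
larger ones. *)
Lemma broom_interval X x y (m : 'I_N.+1) :
  gconnected (induced broom X) -> m <= L -> x <= m <= y ->
  x \in X -> y \in X -> m \in X.
Proof.
move=> cX mL /andP[xm my] xX yX; apply/negPn/negP => mX.
have lt_xm : x < m.
  by rewrite ltn_neqAle xm andbT; apply: contraNneq mX => /val_inj<-.
suff : y < m by rewrite ltnNge my.
apply: (connect_preserved (P := fun z : 'I_N.+1 => z < m)) lt_xm; last first.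
  exact: gconnectedP cX xX yX.
move=> a b; rewrite adj_induced adj_broom => /and3P[ab _ bX] lt_am.
have /eqP neq_bm : b != m by apply: contraNneq mX => <-.
have {}neq_bm : nat_of_ord b <> m by move=> /val_inj.
case/orP: ab => [/has_parent_lt lt_ba|/andP[_ /eqP]].
  exact: ltn_trans lt_am.
by rewrite /parent; clear - lt_am mL neq_bm; lia.
Qed.

(** * Subtrees of a broom and its core center *)

Hypotheses (lt3L : 3 < L) (le2LN : L.*2 <= N).

Lemma leLN : L <= N.
Proof. by clear - le2LN; lia. Qed.

Definition through v u : {set {set 'I_N.+1}} :=
  [set X | [&& gconnected (induced broom X), v \in X & u \in X]].

Lemma num_subtrees_broom v u : num_subtrees broom v u = #|through v u|.
Proof.
rewrite num_subtreesE; first last; [exact: acyclic_broom|exact: simple_broom|].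
by apply: eq_card => X; rewrite !inE subsetT.
Qed.

Lemma throughP v u X : reflect
  [/\ gconnected (induced broom X), v \in X & u \in X] (X \in through v u).
Proof. by rewrite inE; apply: and3P. Qed.

Lemma card_through_far v :
  3 <= v -> #|through v ord0| <= #|through (node 3) ord0|.
Proof.
move=> le3v; apply/subset_leq_card/subsetP => X /throughP[cX vX X0].
have n3 := nodeK (leq_trans (ltnW lt3L) leLN).
apply/throughP; split=> //; apply: broom_interval cX _ _ X0 vX; rewrite n3 //.
exact: ltnW.
Qed.

(** A subtree that contains [0] and [3] contains everything in between; the
path [0, 1, 2] gives the strict inequality. *)
Lemma lt_through_near u :
  u <= 2 -> #|through (node 3) ord0| < #|through (node 2) u|.
Proof.
move=> leu2; have n3 := nodeK (leq_trans (ltnW lt3L) leLN).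
have n2 : node 2 = 2 :> nat by rewrite nodeK //; clear - lt3L le2LN; lia.
apply/proper_card/properP; split.
  apply/subsetP => X /throughP[cX X3 X0].
  have in_int (m : 'I_N.+1) : m <= 3 -> m \in X.
    move=> le; apply: broom_interval cX _ _ X0 X3; rewrite ?n3 //.
    by rewrite (leq_trans le) // ltnW.
  by apply/throughP; split=> //; apply: in_int; rewrite ?n2 // (leq_trans leu2).
exists [set x : 'I_N.+1 | x <= 2].
  apply/throughP; split; rewrite ?inE ?n2 //.
  apply: (@broom_connected _ ord0); rewrite ?inE // => y; rewrite inE => le2y.
  rewrite -lt0n => y0; rewrite y0 inE nodeK /parent;
    by clear - y0 le2y lt3L le2LN; lia.
by apply/throughP => -[_]; rewrite inE n3.
Qed.

(** A subtree [X] that contains [0] but not the hub is a segment of the handle.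
It is encoded by a subtree that starts exactly at [2], contains [l], and whose
further leaves are a copy of [X]: [bump l] makes the copy skip [l].  The vertex
[0] is copied onto the hub. *)
Definition leaf_code l X : {set 'I_N.+1} :=
  [set x : 'I_N.+1 | [|| 2 <= x <= L, x == l |
    [exists z in X, (z < L) && (x == bump l (L + z) :> nat)]]].

(** An injection from the subtrees containing [0] and [3] to those containing
[2] and the leaf [l].  The three cases are told apart by the smallest vertex of
the image, which is [0], [1] or [2] respectively. *)
Definition reroute l X : {set 'I_N.+1} :=
  if l \in X then X
  else if node L \in X then l |: (X :\ ord0) else leaf_code l X.

Lemma bump_leafK l z : 0 < z < L -> L < l ->
  [/\ node (bump l (L + z)) = bump l (L + z) :> nat,
      L < bump l (L + z) & bump l (L + z) <> l].
Proof.
move=> z0 lL; rewrite nodeK /bump; clear - z0 lL le2LN; last lia.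
by split; lia.
Qed.

Lemma leaf_codeE l X z : L < l -> 0 < z < L ->
  (node (bump l (L + z)) \in leaf_code l X) = (z \in X).
Proof.
move=> lL zL; have [nK gtL neq_l] := bump_leafK zL lL.
rewrite inE nK [_ <= L]leqNgt gtL andbF /=.
rewrite (_ : (_ == l) = false) /=; last first.
  by apply/negbTE/eqP => eq; apply: neq_l; rewrite -nK eq.
apply/exists_inP/idP => [[y yX /andP[_ /eqP]]|zX].
  by move=> /(can_inj (bumpK _))/addnI/val_inj->.
by exists z => //; case/andP: zL => _ -> /=.
Qed.

Lemma leaf_code_ge2 l X x : L < l -> x \in leaf_code l X -> 2 <= x.
Proof.
move=> lL; rewrite inE => /or3P[/andP[] //|/eqP->|].
  by clear - lL lt3L; lia.
by case/exists_inP=> z _ /andP[_ /eqP->]; rewrite /bump; clear - lt3L; lia.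
Qed.

(** [reroute l] is injective, and misses the subtree made of the handle from [2]
on and of the single leaf [l]: a leaf code of a subtree that contains [3] has
another leaf. *)
Lemma lt_through_leaf l : L < l ->
  #|through (node 3) ord0| < #|through (node 2) l|.
Proof.
move=> lL; have leLN := leLN.
have n3 := nodeK (leq_trans (ltnW lt3L) leLN).
have n2 : node 2 = 2 :> nat by rewrite nodeK //; clear - lt3L le2LN; lia.
have n1 : node 1 = 1 :> nat by rewrite nodeK //; clear - lt3L le2LN; lia.
have nL := nodeK leLN.
have inL X x y : X \in through (node 3) ord0 -> x \in X -> y <= x -> y <= L ->
    y \in X.
  move=> /throughP[cX _ X0] xX yx yL.
  by apply: broom_interval cX _ _ X0 xX.
have in3 X y : X \in through (node 3) ord0 -> y <= 3 -> y \in X.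
  move=> tX y3; have /throughP[_ X3 _] := tX.
  apply: inL tX X3 _ _; rewrite ?n3 //.
  by rewrite (leq_trans y3) // ltnW.
have neq0l : ord0 != l by rewrite eq_sym -val_eqE /= -lt0n; clear - lL; lia.
have neq10 : node 1 != ord0 by rewrite -val_eqE /= n1.
have neq20 : node 2 != ord0 by rewrite -val_eqE /= n2.
(* [tag0] and [tag1] recover the case of [reroute] from its value. *)
have tag0 X : X \in through (node 3) ord0 ->
    (ord0 \in reroute l X) = (l \in X).
  move=> tX; rewrite /reroute; case: ifP => [_|lX]; first by rewrite in3.
  case: ifP => _; first by rewrite !inE eqxx (negbTE neq0l).
  by apply/negP => /(leaf_code_ge2 lL).
have tag1 X : X \in through (node 3) ord0 ->
    (node 1 \in reroute l X) = (l \in X) || (node L \in X).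
  move=> tX; have X1 : node 1 \in X by rewrite in3 ?n1.
  rewrite /reroute; case: ifP => [_|lX] //=.
  case: ifP => _; first by rewrite !inE neq10 X1 orbT.
  by apply/negP => /(leaf_code_ge2 lL); rewrite n1.
have inj : {in through (node 3) ord0 &, injective (reroute l)}.
  move=> X Y tX tY eqXY.
  have := tag0 X tX; rewrite eqXY tag0 // => eql.
  have := tag1 X tX; rewrite eqXY tag1 // eql.
  case: (boolP (l \in X)) (eql) => [lX lY _|lX lY /= eqL].
    by move: eqXY; rewrite /reroute lX lY.
  move: eqXY; rewrite /reroute lY (negbTE lX) eqL.
  case: ifP => [_ /setP eqXY|XL /setP eqXY]; apply/setP => z.
    have [->|z0] := eqVneq z ord0; first by rewrite !in3.
    have [->|zl] := eqVneq z l; first by rewrite lY (negbTE lX).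
    by have := eqXY z; rewrite !inE z0 (negbTE zl).
  have [zL|zL] := ltnP z L.
    have [->|z0] := eqVneq z ord0; first by rewrite !in3.
    have z0L : 0 < z < L by rewrite lt0n z0.
    by have := eqXY (node (bump l (L + z))); rewrite !leaf_codeE.
  apply/idP/idP => zZ.
    by move: XL; rewrite (inL X z (node L) tX) ?nL.
  by move: XL; rewrite -eqL (inL Y z (node L) tY) ?nL.
rewrite -(card_in_imset inj); apply/proper_card/properP; split.
  apply/subsetP => _ /imsetP[X tX ->]; have /throughP[cX X3 X0] := tX.
  have X2 : node 2 \in X by rewrite in3 ?n2.
  rewrite /reroute; case: ifP => [lX|lX]; first exact/throughP.
  case: ifP => XL; apply/throughP; split; rewrite ?inE ?eqxx ?orbT //.
  - apply: (@broom_connected_tail _ (node 1)); rewrite ?n1.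
    + by clear - lt3L; lia.
    + move=> x /andP[x0 xL]; rewrite !inE -lt0n x0 /=.
      by rewrite (inL X (node L) x tX) ?nL ?orbT.
    + move=> x; rewrite !inE => /orP[/eqP->|/andP[x0 _]].
        by clear - lL; lia.
      by rewrite lt0n.
  - by rewrite neq20 X2 orbT.
  - apply: (@broom_connected_tail _ (node 2)); rewrite ?n2.
    + by clear - lt3L; lia.
    + by move=> x xL; rewrite inE xL.
    + by move=> x; apply: leaf_code_ge2.
  - by rewrite n2 /= (leq_trans _ (ltnW lt3L)).
exists (leaf_code l set0).
  apply/throughP; split; rewrite ?inE ?eqxx ?orbT //.
    apply: (@broom_connected_tail _ (node 2)); rewrite ?n2.
    + by clear - lt3L; lia.
    + by move=> x xL; rewrite inE xL.
    + by move=> x; apply: leaf_code_ge2.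
  by rewrite n2 /= (leq_trans _ (ltnW lt3L)).
apply/imsetP => -[X tX eqX]; have := tag1 X tX.
rewrite -eqX; case: (boolP (node 1 \in _)) => [/(leaf_code_ge2 lL)|_].
  by rewrite n1.
move/esym/negbT; rewrite negb_or => /andP[lX XL].
move: eqX; rewrite /reroute (negbTE lX) (negbTE XL) => /setP.
move=> /(_ (node (bump l (L + node 3)))).
have /andP L3 : 0 < node 3 < L by rewrite n3.
by rewrite !leaf_codeE ?n3 // in_set0 in3 ?n3.
Qed.

(** The eccentric number of a vertex [y >= 3] is bounded by the number of
subtrees containing [0] and [3], and that of [2] exceeds this number, whichever
vertex [u] realizes it. *)
Lemma core_center_broom y : y \in core_center broom -> y <= 2.
Proof.
move=> /setIdP[_ /forall_inP/(_ (node 2) (in_setT _))].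
apply: contraLR; rewrite -!ltnNge => le3y.
apply: (@leq_ltn_trans #|through (node 3) ord0|).
  apply: leq_trans (ecc_subtree_le (u := ord0) _ _) _; rewrite ?in_setT //.
  by rewrite num_subtrees_broom card_through_far.
apply: ecc_subtree_gt => [|u _]; rewrite ?in_setT // num_subtrees_broom.
have [/lt_through_near//|lt2u] := leqP u 2.
have [leuL|/lt_through_leaf//] := leqP u L.
(* For [u] on the handle beyond [2], going on to a leaf only loses subtrees. *)
have nl : node L.+1 = L.+1 :> nat by rewrite nodeK //; clear - le2LN lt3L; lia.
have lL : L < node L.+1 by rewrite nl.
apply: leq_trans (lt_through_leaf lL) _.
apply/subset_leq_card/subsetP => X /throughP[cX X2 Xl].
apply/throughP; split=> //; apply: broom_interval cX (leuL) _ X2 Xl.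
rewrite nl nodeK; last by clear - le2LN lt3L; lia.
by rewrite ltnW // (leq_trans leuL).
Qed.

(** * The centroid of a broom *)

(** A branch at the hub is either the handle or a single edge to a leaf. *)
Lemma weight_broom_hub : weight broom (node L) <= L.
Proof.
have nL := nodeK leLN; apply: weight_leq => K pK.
have /and3P[/andP[/and3P[_ _ eK] tK] _ _] := pK.
have sK : simple_graph K by case/and3P: tK.
have [c [eLc _ conn]] := pendantP pK.
rewrite -ltnS; apply: leq_trans (tree_card_eset tK) _.
have [Lc _ _] := adj_vset sK eLc.
have neqcL : nat_of_ord c <> L.
  by rewrite -nL => /val_inj eq; rewrite eq eqxx in Lc.
have off_step a b : adj_off K (node L) a b ->
    [/\ nat_of_ord a <> L, nat_of_ord b <> L &
        has_parent a b \/ has_parent b a].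
  case/and3P=> aL bL /(adj_sub eK); rewrite adj_broom => /orP par.
  rewrite -nL; split=> // /val_inj eq; last by rewrite eq eqxx in bL.
  by rewrite eq eqxx in aL.
have [ltcL|leLc] := ltnP c L.
  suff sub : vset K \subset [set node i | i : 'I_L.+1].
    apply: leq_trans (subset_leq_card sub) _.
    by apply: leq_trans (leq_imset_card _ _) _; rewrite card_ord.
  apply/subsetP => x xK.
  suff lexL : x <= L.
    apply/imsetP; exists (Ordinal (lexL : x < L.+1)) => //.
    by apply: val_inj; rewrite /= nodeK // -ltnS.
  have [->|xL] := eqVneq x (node L); first by rewrite nL.
  apply: ltnW.
  apply: (connect_preserved (P := fun z : 'I_N.+1 => z < L)) ltcL; last first.
    exact: conn xK xL.
  move=> a b /off_step[_ bL [/has_parent_lt|/andP[_ /eqP]]].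
    by move=> lt_ba /(ltn_trans lt_ba).
  by rewrite /parent; clear - bL; lia.
suff sub : vset K \subset [set node L; c].
  apply: leq_trans (subset_leq_card sub) _.
  by rewrite cards2; clear - lt3L; case: (_ != _); lia.
apply/subsetP => x xK; rewrite !inE.
have [//|xL /=] := eqVneq x (node L).
apply: (connect_preserved (P := pred1 c) _ (conn x xK xL)) (eqxx c).
move=> a b /off_step[aL bL par] /eqP eq_ac; move: par; rewrite {}eq_ac in aL *.
rewrite /has_parent /parent => -[] /andP[_ /eqP].
  by clear - leLc neqcL bL; lia.
by clear - leLc neqcL bL; lia.
Qed.

(** The branch at [x] away from the tip has an edge to [x.+1], and the edges
joining the vertices [x + i.+2] to their parents; using those with [i < L]
suffices. *)
Lemma weight_broom_handle x : x < L -> L < weight broom x.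
Proof.
move=> ltxL; pose X := [set y : 'I_N.+1 | x < y].
have leN i : i <= L -> x + i.+1 <= N by clear - ltxL le2LN; lia.
have nx : node x.+1 = x.+1 :> nat by rewrite nodeK // -addn1 leN.
have cX : gconnected (induced broom X).
  apply: (@broom_connected_tail _ (node x.+1)); rewrite ?nx //.
    by move=> y /andP[lt _]; rewrite inE.
  by move=> y; rewrite inE.
have stX : is_subtree (induced broom X) broom.
  rewrite /is_subtree /is_subgraph /is_tree subsetT eset_induced cX.
  rewrite simple_induced ?simple_broom //.
  by rewrite (acyclic_sub (eset_induced _ _)) ?acyclic_broom.
have [] := add_pendant_subtree (a := node x.+1) (v := x) simple_broom
  acyclic_broom stX.
- by rewrite inE nx.
- by rewrite inE ltnn.
- rewrite adj_broom; apply/orP; right; rewrite /has_parent nx /parent.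
  by clear - ltxL; apply/eqP; lia.
move=> pX cardX; apply: leq_trans (pendant_le_weight pX).
rewrite cardX ltnS.
pose f (i : 'I_L) := [set node (x + i.+2); node (parent (x + i.+2))].
have nK (i : 'I_L) : node (x + i.+2) = x + i.+2 :> nat.
  by rewrite nodeK // leN.
have pK (i : 'I_L) : node (parent (x + i.+2)) = parent (x + i.+2) :> nat.
  rewrite nodeK // /parent; have := leN _ (ltn_ord i).
  by clear; lia.
have inj_f : injective f.
  move=> i j /eq_set2[[/(congr1 val)/=]|[/(congr1 val)/= + /(congr1 val)/=]].
    by rewrite !nK => /addnI [] /val_inj.
  rewrite !nK !pK /parent => *; apply: val_inj => /=; lia.
rewrite -{1}[L]card_ord -(card_imset _ inj_f); apply: subset_leq_card.
apply/subsetP => _ /imsetP[i _ ->]; rewrite inE subUset !sub1set !inE nK pK.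
have par : has_parent (node (x + i.+2)) (node (parent (x + i.+2))).
  by rewrite /has_parent nK pK eqxx addnS.
apply/and3P; split.
- apply/existsP; exists (node (x + i.+2)).
  by apply/existsP; exists (node (parent (x + i.+2))); rewrite par eqxx.
- by clear; lia.
- by rewrite /parent; clear - ltxL; lia.
Qed.

Lemma centroid_broom x : x \in centroid broom -> L <= x.
Proof.
move=> /setIdP[_ /forall_inP/(_ (node L) (in_setT _))].
apply: contraLR; rewrite -!ltnNge => /weight_broom_handle.
exact: leq_ltn_trans weight_broom_hub.
Qed.

(** [minn x L] is the position of [x] along the handle, leaves being placed at
the hub; an edge changes it by at most one. *)
Lemma path_broom x p : path (adj broom) x p ->
  minn x L <= minn (last x p) L + size p.
Proof.
elim: p x => [|y p IHp] x /=; first by rewrite addn0.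
case/andP; rewrite adj_broom /has_parent /parent => exy /IHp.
have step : minn x L <= (minn y L).+1.
  by case/orP: exy => /andP[_ /eqP->]; clear; lia.
by rewrite addnS -addSn => le; apply: leq_trans step _; rewrite ltnS in le *.
Qed.

Lemma centroid_core_dist_broom : L - 2 <= centroid_core_dist broom.
Proof.
apply: le_set_dist => [|x y /centroid_broom leLx /core_center_broom ley2].
  by rewrite card_ord; clear - le2LN; lia.
have [p /and3P[/path_broom le_p /eqP eq_y _] ->] :=
  tdist_upath broom_is_tree (in_setT x) (in_setT y).
by move: le_p; rewrite eq_y; clear - leLx ley2; lia.
Qed.

End Broom.

(** * Bounds on delta and the limit *)

Lemma delta_le n : (delta n).*2 <= n.
Proof.
rewrite -geq_half_double; apply/bigmax_leqP => T /andP[tT /eqP card_T].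
by rewrite geq_half_double (leq_trans (centroid_core_dist_le tT)) ?card_T.
Qed.

Lemma le_delta n : n <= (delta n).*2 + 8.
Proof.
have [/leq_trans->|] := leqP n 8; rewrite ?leq_addl //.
case: n => // N; rewrite ltnS => le8N; pose L := N./2.
have lt3L : 3 < L by rewrite /L; clear - le8N; lia.
have le2LN : L.*2 <= N by rewrite /L; clear; lia.
have := centroid_core_dist_broom lt3L le2LN.
have : centroid_core_dist (broom N L) <= delta N.+1.
  apply: (@leq_bigmax_cond _ _ (fun T => centroid_core_dist T)).
  by rewrite broom_is_tree cardsT card_ord eqxx.
have : N <= L.*2.+1 by rewrite /L; clear; lia.
by move: (centroid_core_dist _) (delta _) => d d'; clear; lia.
Qed.

From mathcomp Require Import all_boot all_order all_algebra.
From mathcomp Require Import all_classical all_reals all_analysis.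
From mathcomp Require Import lra.
Import Order.TTheory GRing.Theory Num.Theory.
Import numFieldNormedType.Exports.
Local Open Scope classical_set_scope.
Local Open Scope ring_scope.

Theorem proposition5p18 (R : realType) :
  (delta n)%:R / n%:R @[n --> \oo] --> (1 / 2 : R).
Proof.
have lim_lower : (1 / 2 - 4%:R * n%:R^-1 : R) @[n --> \oo] --> (1 / 2 : R).
  rewrite -[X in _ --> X]subr0 -[X in _ - X](mulr0 4%:R).
  apply: cvgB; first exact: cvg_cst.
  apply: cvgM; first exact: cvg_cst.
  by rewrite gtr0_cvgV0; [exact: cvgr_idn | exists 1 => // n; rewrite ltr0n].
apply: (squeeze_cvgr _ lim_lower); last exact: cvg_cst.
near=> n.
have n0 : 0 < n%:R :> R by rewrite ltr0n; near: n; exists 1.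
have le1 : (delta n)%:R * 2 <= n%:R :> R.
  by rewrite -natrM ler_nat muln2 delta_le.
have le2 : n%:R <= (delta n)%:R * 2 + 8%:R :> R.
  by rewrite -natrM -natrD ler_nat muln2 le_delta.
apply/andP; split; last by rewrite ler_pdivrMr //; lra.
rewrite ler_pdivlMr // mulrBl -[4%:R * _ * _]mulrA mulVf ?gt_eqF //.
by lra.
Unshelve. all: by end_near.
Qed.
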